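(* Let $G=(V,E)$ be a graph with $n$ vertices, and let $S$ be a $(\kappa,\tau)$-regular subset of $V$ with cardinality $n_1$ and $\kappa\le\tau$. Suppose that there exists a vertex $v\in S$ with no neighbors in $S^c$. Then $$S_L(G)\ >\ \frac{\tau n}{n_1}-\kappa .$$
   Context: Graphs are finite, simple and undirected. For a graph $G$ with $n$ vertices, $L(G)=D(G)-A(G)$ is the Laplacian matrix ($D(G)$ the diagonal matrix of vertex degrees, $A(G)$ the adjacency matrix), with eigenvalues $\mu_1\ge\dots\ge\mu_{n-1}\ge\mu_n=0$. The Laplacian spread is $S_L(G)=\mu_1-\mu_{n-1}$. For $S\subseteq V$, $S^c=V\setminus S$. A nonempty proper subset $S$ of $V$ is $(\kappa,\tau)$-regular if the subgraph induced by $S$ is $\kappa$-regular and every vertex in $S^c$ has exactly $\tau$ neighbors in $S$.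
   Formalization: The graph G is additionally assumed to have at least one edge; for an edgeless graph κ = τ = 0 and both sides equal 0, so the strict inequality fails. *)

(* Defs.v *)
From HB Require Import structures.
From mathcomp Require Export all_boot all_order all_algebra.
From mathcomp Require Export polyrcf.

Set Implicit Arguments.
Unset Strict Implicit.
Unset Printing Implicit Defensive.

Import Order.TTheory GRing.Theory Num.Theory.
Local Open Scope ring_scope.

Record sgraph (V : finType) := SGraph {
  adj :> rel V;
  adj_sym : symmetric adj;
  adj_irrefl : irreflexive adj }.

Section Graph.
Variables (V : finType) (G : sgraph V).

Definition neighbors (x : V) : {set V} := [set y | adj G x y].

Definition degree (x : V) : nat := #|neighbors x|.

(* For x in S, [neighbors x :&: S] is the neighborhood of x in the subgraph
   induced by S. *)
Definition kt_regular (S : {set V}) (kappa tau : nat) : Prop :=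
  [/\ S != set0, S \proper [set: V],
      forall x, x \in S -> #|neighbors x :&: S| = kappa &
      forall x, x \in ~: S -> #|neighbors x :&: S| = tau].

End Graph.

Section Spectrum.
Variable R : rcfType.

(* The eigenvalues of A that lie in R, in nonincreasing order, each repeated
   according to its algebraic multiplicity. For a symmetric A of order n all
   eigenvalues are real, so this list has length n. *)
Definition eigenvalues n (A : 'M[R]_n) : seq R :=
  sort (fun x y => y <= x)
    (flatten [seq nseq (mup x (char_poly A)) x | x <- rootsR (char_poly A)]).

Variables (V : finType) (G : sgraph V).

(* The vertices are numbered by [enum_val]; the spectrum does not depend on the
   numbering. *)
Definition adjacency_mx : 'M[R]_#|V| :=
  \matrix_(i, j) (adj G (enum_val i) (enum_val j))%:R.

Definition degree_mx : 'M[R]_#|V| :=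
  diag_mx (\row_i (degree G (enum_val i))%:R).

Definition laplacian_mx : 'M[R]_#|V| := degree_mx - adjacency_mx.

(* [laplacian_eigenvalue i] is mu_i with the indices starting at 1:
   mu_1 >= ... >= mu_n, where n = #|V|. *)
Definition laplacian_eigenvalue (i : nat) : R :=
  (eigenvalues laplacian_mx)`_i.-1.

(* Meaningful when #|V| >= 2. *)
Definition laplacian_spread : R :=
  laplacian_eigenvalue 1 - laplacian_eigenvalue #|V|.-1.

End Spectrum.

(* Main.v *)
Require Import Defs.
From mathcomp Require Import all_boot all_order all_algebra.
From mathcomp Require Import polyrcf complex ring lra zify.

Set Implicit Arguments.
Unset Strict Implicit.
Unset Printing Implicit Defensive.

Import Order.TTheory GRing.Theory Num.Theory.
Local Open Scope ring_scope.

(** Write L for the Laplacian and mu_1 >= ... >= mu_n for its eigenvalues.  The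
    two inequalities mu_1 > tau n / n1 and mu_(n-1) <= kappa give the bound, and
    each comes from one test vector.

    For mu_1 the test vector is n - n1 on S and - n1 outside S.  Regularity makes
    its Rayleigh quotient exactly tau n / n1, so mu_1 is at least that.  In case
    of equality the vector would be an eigenvector
    ([rayleigh_top_eigenvector]), which fails at v: the vector is constant on v
    and its neighbors, so L sends it to 0 at v, while tau n / n1 times its value
    there is positive.  If tau = 0 the argument degenerates and one only needs
    mu_1 > 0, which an edge provides.

    For mu_(n-1), the vertex v has kappa neighbors, all in S, hence it is not
    adjacent to every other vertex.  Deleting its neighbors isolates v from the
    set T of the remaining vertices, and the vector equal to |T| at v, 0 on the
    neighbors and - 1 on T is orthogonal to the constants, with Rayleigh quotient
    at most the degree of v ([algebraic_connectivity_le_degree]).  By the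
    Courant-Fischer principle, in the form [second_smallest_le_rayleigh],
    mu_(n-1) is at most kappa.

    Both variational facts rest on diagonalizing a real symmetric matrix in a
    unitary basis over the complex numbers R[i]; the eigenvalues are real, so this
    also identifies the list of roots of the characteristic polynomial over R. *)

(** * Spectral coordinates of real symmetric matrices *)

Lemma char_poly_conj (F : fieldType) n (P D : 'M[F]_n) :
  P \in unitmx -> char_poly (invmx P *m D *m P) = char_poly D.
Proof.
move=> Pu; rewrite /char_poly.
have VP : map_mx polyC (invmx P) *m map_mx polyC P = 1%:M.
  by rewrite -map_mxM mulVmx // map_mx1.
have -> : char_poly_mx (invmx P *m D *m P)
    = map_mx polyC (invmx P) *m char_poly_mx D *m map_mx polyC P.
  rewrite /char_poly_mx mulmxBr mulmxBl !map_mxM scalar_mxC.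
  by rewrite -(mulmxA _%:M) VP mulmx1.
by rewrite !det_mulmx mulrAC -det_mulmx VP det1 mul1r.
Qed.

Section SpectralCoordinates.
Local Open Scope sesquilinear_scope.

(** The spectral theorem over R[i], reduced to what is needed about real vectors:
    [Y x] are the coordinates of [x] in a unitary eigenbasis.  The coordinates
    are complex, but the eigenvalues [d] are in R because a real symmetric matrix
    is Hermitian. *)
Lemma symmetric_spectral_coordinates (R : rcfType) n (A : 'M[R]_n) :
  A^T = A ->
  exists (d : 'I_n -> R) (Y : 'rV[R]_n -> 'I_n -> R[i]),
  [/\ char_poly A = \prod_(i < n) ('X - (d i)%:P),
      forall a (x : 'rV_n) i, Y (a *: x) i = a%:C%C * Y x i,
      forall x z, ((x *m z^T) 0 0)%:C%C = \sum_i Y x i * (Y z i)^* &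
      forall x i, Y (x *m A) i = (d i)%:C%C * Y x i].
Proof.
move=> Asym; pose C m p (M : 'M_(m, p)) := map_mx (real_complex R) M.
have Creal m p (M : 'M[R]_(m, p)) : C _ _ M \is a realmx.
  by apply/mxOverP => i j; rewrite mxE; apply/complex_realP; exists (M i j).
have AH : C _ _ A \is hermsymmx.
  apply: realsym_hermsym => //; apply/is_hermitianmxP.
  by rewrite expr0 scale1r map_mx_id // /C map_trmx Asym.
have /orthomx_spectralP := hermitian_normalmx AH.
have Pu := spectral_unitarymx (C _ _ A).
have := hermitian_spectral_diag_real AH.
move: (spectralmx _) (spectral_diag _) Pu => P D Pu Dreal AE.
have PU := unitarymx_unit Pu.
(* Replacing D by its real part changes nothing and brings d into R. *)
have DE : D = C _ _ (map_mx (@complex.Re R) D).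
  apply/rowP => i; rewrite !mxE RRe_real //; exact: (mxOverP Dreal).
pose d i := complex.Re (D 0 i).
have Dd i : D 0 i = (d i)%:C%C by rewrite {1}DE !mxE.
exists d, (fun x i => (C _ _ x *m P^t*) 0 i); split.
- apply: (map_poly_inj (real_complex R)).
  rewrite map_char_poly /= -[map_mx _ A]/(C _ _ A) AE char_poly_conj //.
  rewrite char_poly_trig ?diag_mx_is_trig // rmorph_prod /=.
  apply: eq_bigr => i _; rewrite mxE eqxx mulr1n Dd.
  by rewrite rmorphB /= map_polyX map_polyC.
- by move=> a x i; rewrite /C map_mxZ -scalemxAl mxE.
- move=> x z; transitivity ((C _ _ x *m (C _ _ z)^T) 0 0).
    by rewrite map_trmx -map_mxM [RHS]mxE.
  have -> : C _ _ x *m (C _ _ z)^T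
    = (C _ _ x *m P^t*) *m (C _ _ z *m P^t*)^t*.
    rewrite trmx_mul map_mxM trmxCK !mulmxA mulmxKtV //.
    by congr (_ *m _); rewrite -map_trmx realmxC.
  by rewrite mxE; apply: eq_bigr => i _; rewrite !mxE.
- move=> x i; rewrite /C map_mxM -/(C _ _ A) AE invmx_unitary // !mulmxA.
  by rewrite mulmxtVK // mul_mx_diag mxE Dd mulrC.
Qed.

End SpectralCoordinates.

(** Equality of multiplicities: the multiplicity of [x] as a root of a product of
    linear factors is the number of factors vanishing at [x]. *)
Lemma perm_eigenvalues (R : rcfType) n (A : 'M[R]_n) (d : 'I_n -> R) :
  char_poly A = \prod_(i < n) ('X - (d i)%:P) ->
  perm_eq (eigenvalues A) (codom d).
Proof.
move=> Ad; rewrite /eigenvalues perm_sort.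
have p0 : char_poly A != 0 by rewrite monic_neq0 ?char_poly_monic.
apply/allP => x _; apply/eqP => /=.
have /= <- : mup x (char_poly A) = count_mem x (codom d).
  rewrite Ad codomE count_map -big_enum /=.
  elim: (enum _) => [|i s IHs] /=; first by rewrite big_nil mupNroot ?root1.
  rewrite big_cons mupM ?polyXsubC_eq0 ?monic_neq0 ?monic_prod_XsubC //.
  by rewrite IHs -['X - _]expr1 mup_XsubCX; case: eqP.
rewrite count_flatten -map_comp.
have U : uniq (rootsR (char_poly A)) by exact: uniq_roots.
have M := roots_on_rootsR p0 x.
have [xr|xr] := boolP (x \in rootsR (char_poly A)); last first.
  rewrite mupNroot; last by rewrite -M in_itv /= in xr *.
  rewrite sumnE big_map big1_seq // => y /andP[_ yr].
  by rewrite /= count_nseq /=; case: eqP => [yx|]; rewrite ?mul0n // -yx yr in xr.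
rewrite sumnE big_map (bigD1_seq x) //= count_nseq /= eqxx mul1n.
by rewrite big1 ?addn0 // => y /negPf yx; rewrite count_nseq /= yx.
Qed.

Lemma eigenvalues_nonincreasing (R : rcfType) n (A : 'M[R]_n) i j :
  (i <= j < size (eigenvalues A))%N ->
  (eigenvalues A)`_j <= (eigenvalues A)`_i.
Proof.
case/andP=> ij js; apply: (@sorted_leq_nth _ (fun x y => y <= x)) => //.
- by move=> ? ? ? h1 h2; apply: le_trans h2 h1.
- by apply: sort_sorted => ? ?; apply: le_total.
- by rewrite inE (leq_ltn_trans ij).
Qed.

Lemma size_eigenvalues (R : rcfType) n (A : 'M[R]_n) :
  A^T = A -> size (eigenvalues A) = n.
Proof.
move=> /symmetric_spectral_coordinates[d [Y [Ad _ _ _]]].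
by rewrite (perm_size (perm_eigenvalues Ad)) size_codom card_ord.
Qed.

(** In nonincreasing order all entries but the last are at least the one before
    the last, which sits at index [n.-2]. *)
Lemma count_eigenvalues_le (R : rcfType) n (A : 'M[R]_n) (c : R) :
  A^T = A -> (1 < n)%N -> c < (eigenvalues A)`_n.-2 ->
  (count (fun y => y <= c)%R (eigenvalues A) <= 1)%N.
Proof.
move=> Asym n1 c_lt; have sz := size_eigenvalues Asym.
rewrite -(cat_take_drop n.-1 (eigenvalues A)) count_cat.
have -> : count (fun y => y <= c)%R (take n.-1 (eigenvalues A)) = 0%N.
  apply/eqP; rewrite -leqn0 leqNgt -has_count; apply/hasPn => y /(nthP 0)[k].
  rewrite size_take sz ltn_predL (ltnW n1) => kn <-.
  rewrite nth_take // -ltNge; apply: lt_le_trans c_lt _.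
  apply: eigenvalues_nonincreasing; rewrite sz.
  by case: (n) n1 kn => [|[|m]] //= _; rewrite ltnS leqnSn andbT.
rewrite add0n (leq_trans (count_size _ _)) // size_drop sz.
by case: (n) n1 => // k _; rewrite /= subSnn.
Qed.

(** * Variational bounds on the extreme eigenvalues *)

Lemma row_dot_eq0 (R : realFieldType) n (x : 'rV[R]_n) :
  ((x *m x^T) 0 0 == 0) = (x == 0).
Proof.
apply/idP/eqP => [|->]; last by rewrite mul0mx mxE.
rewrite mxE psumr_eq0 => [/allP h|i _]; last by rewrite mxE -expr2 sqr_ge0.
apply/rowP => i; have := h i (mem_index_enum i).
by rewrite !mxE /= mulf_eq0 orbb => /eqP.
Qed.

(** In spectral coordinates the hypotheses say that the sum of the nonnegative
    terms (c - d_i) |y_i|^2 is at most 0.  So they all vanish: y_i is zero unless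
    d_i = c, which is the equation of an eigenvector.  Used through its
    contrapositive, this yields strict lower bounds on the largest eigenvalue. *)
Lemma rayleigh_top_eigenvector (R : rcfType) n (A : 'M[R]_n)
    (x : 'rV_n) (c : R) :
  A^T = A -> (eigenvalues A)`_0 <= c ->
  c * (x *m x^T) 0 0 <= (x *m A *m x^T) 0 0 -> x *m A = c *: x.
Proof.
move=> /symmetric_spectral_coordinates[d [Y [Ad YZ dotE YA]]] le_c le_q.
have pe := perm_eigenvalues Ad.
have dc i : d i <= c.
  apply: le_trans le_c.
  have di : d i \in eigenvalues A by rewrite (perm_mem pe) codom_f.
  by rewrite -(nth_index 0 di) eigenvalues_nonincreasing // index_mem.
have cd i : (c - d i)%:C%C * (Y x i * (Y x i)^*) = 0.
  have pos j : 0 <= (c - d j)%:C%C * (Y x j * (Y x j)^*).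
    by rewrite mulr_ge0 ?mul_conjC_ge0 // ler0c subr_ge0.
  have : \sum_j (c - d j)%:C%C * (Y x j * (Y x j)^*) == 0.
    rewrite eq_le sumr_ge0 // andbT.
    rewrite (eq_bigr (fun j => c%:C%C * (Y x j * (Y x j)^*)
        - Y (x *m A) j * (Y x j)^*)); last first.
      by move=> j _; rewrite YA rmorphB /= mulrBl !mulrA.
    rewrite sumrB -mulr_sumr -!dotE -rmorphM -rmorphB /=.
    by rewrite -(rmorph0 (real_complex R)) lecR subr_le0.
  rewrite psumr_eq0 //.
  by move=> /allP/(_ i (mem_index_enum i))/eqP.
have YE i : Y (x *m A) i = c%:C%C * Y x i.
  move/eqP: (cd i); rewrite mulf_eq0 mul_conjC_eq0 fmorph_eq0 subr_eq0.
  case/orP => [/eqP ->|/eqP y0]; first by rewrite YA.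
  by rewrite YA y0 !mulr0.
(* Entries are dot products with basis vectors, hence determined by Y. *)
have coordE (z : 'rV_n) j : z 0 j = (z *m (delta_mx 0 j : 'rV[R]_n)^T) 0 0.
  by rewrite trmx_delta -colE mxE.
apply/rowP => j; rewrite [RHS]mxE (coordE x) (coordE (x *m A)).
apply: complexI; rewrite rmorphM /= !dotE mulr_sumr.
by apply: eq_bigr => i _; rewrite YE mulrA.
Qed.

(** If the second smallest eigenvalue exceeded [c], only one coordinate [i0] would
    have its eigenvalue at most [c].  The eigenvector [u] is then supported at
    [i0], orthogonality to [u] kills the coordinate [i0] of [x], and the Rayleigh
    quotient of [x] would exceed [c].  With [u] the constant vector this bounds
    the algebraic connectivity of a graph. *)
Lemma second_smallest_le_rayleigh (R : rcfType) n (A : 'M[R]_n)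
    (u x : 'rV_n) (l c : R) :
  A^T = A -> (1 < n)%N -> u != 0 -> u *m A = l *: u -> l <= c ->
  x != 0 -> (x *m u^T) 0 0 = 0 ->
  (x *m A *m x^T) 0 0 <= c * (x *m x^T) 0 0 -> (eigenvalues A)`_n.-2 <= c.
Proof.
move=> Asym n1 u0 uA lc x0 xu q_le.
have [d [Y [Ad YZ dotE YA]]] := symmetric_spectral_coordinates Asym.
rewrite leNgt; apply/negP => c_lt.
have pe := perm_eigenvalues Ad.
have Y0 z : (forall i, Y z i = 0) -> z = 0.
  move=> h; apply/eqP; rewrite -row_dot_eq0; apply/eqP/complexI; rewrite dotE.
  by rewrite big1 // => i _; rewrite h mul0r.
have Yu i : (l - d i)%:C%C * Y u i = 0.
  by rewrite rmorphB mulrBl -YZ -uA YA subrr.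
have [i0 ui0] : exists i, Y u i != 0.
  apply/existsP; rewrite -negb_forall; apply: contra u0 => /forallP h.
  by apply/eqP/Y0 => i; apply/eqP.
have di0 : d i0 = l.
  move/eqP: (Yu i0); rewrite mulf_eq0 (negPf ui0) orbF.
  by rewrite fmorph_eq0 subr_eq0 => /eqP.
have cnt : (#|[pred i | (d i <= c)%R]| <= 1)%N.
  have -> : #|[pred i | (d i <= c)%R]|
      = count (fun y => y <= c)%R (eigenvalues A).
    by rewrite (permP pe) codomE count_map -size_filter cardE enumT.
  exact: count_eigenvalues_le Asym n1 c_lt.
have dgt i : i != i0 -> c < d i.
  move=> ii0; rewrite ltNge; apply/negP => dic.
  have /card_le1_eqP := cnt => /(_ i i0); rewrite !inE di0 => /(_ dic lc) ii.
  by rewrite ii eqxx in ii0.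
have Yui i : i != i0 -> Y u i = 0.
  move=> ii0; move/eqP: (Yu i); rewrite mulf_eq0 => /orP[|/eqP //].
  rewrite fmorph_eq0 subr_eq0 => /eqP ld.
  by move: (dgt _ ii0); rewrite -ld ltNge lc.
have Yx0 : Y x i0 = 0.
  move/(congr1 (real_complex R)): xu; rewrite dotE (bigD1 i0) //= big1 ?addr0.
    move/eqP; rewrite mulf_eq0 conjC_eq0 (negPf ui0) orbF => /eqP //.
  by move=> i ii0; rewrite Yui // conjC0 mulr0.
have pos j : 0 <= (d j - c)%:C%C * (Y x j * (Y x j)^*).
  have [->|jj] := eqVneq j i0; first by rewrite Yx0 mul0r mulr0.
  by rewrite mulr_ge0 ?mul_conjC_ge0 // ler0c subr_ge0 ltW ?dgt.
case/eqP: x0; apply: Y0 => i; have [->//|ii0] := eqVneq i i0.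
have : \sum_j (d j - c)%:C%C * (Y x j * (Y x j)^*) == 0.
  rewrite eq_le sumr_ge0 // andbT.
  rewrite (eq_bigr (fun j => Y (x *m A) j * (Y x j)^*
      - c%:C%C * (Y x j * (Y x j)^*))); last first.
    by move=> j _; rewrite YA rmorphB /= mulrBl !mulrA.
  rewrite sumrB -mulr_sumr -!dotE -rmorphM -rmorphB /=.
  by rewrite -(rmorph0 (real_complex R)) lecR subr_le0.
rewrite psumr_eq0 // => /allP/(_ i).
rewrite mem_index_enum => /(_ isT) /=.
rewrite mulf_eq0 mul_conjC_eq0 => /orP[|/eqP //].
rewrite fmorph_eq0 subr_eq0 => /eqP dc.
by have := dgt _ ii0; rewrite dc ltxx.
Qed.

(** * The Laplacian acting on functions of the vertices *)

Section Laplacian.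
Variables (R : rcfType) (V : finType) (G : sgraph V).
Implicit Types f g : V -> R.

Definition vertex_row f : 'rV[R]_#|V| := \row_i f (enum_val i).

(** The Laplacian as an operator on functions: writing it as a sum of differences
    makes locally constant test functions immediate to evaluate. *)
Definition laplacian f (v : V) : R := \sum_(u in neighbors G v) (f v - f u).

Lemma vertex_row_dot f g :
  (vertex_row f *m (vertex_row g)^T) 0 0 = \sum_v f v * g v.
Proof.
rewrite mxE (big_enum_val (A := V) (fun v => f v * g v)) /=.
by apply: eq_bigr => i _; rewrite !mxE.
Qed.

Lemma vertex_row_eq0 f : (vertex_row f == 0) = [forall v, f v == 0].
Proof.
apply/eqP/forallP => [/rowP f0 v|f0];
  last by apply/rowP => i; rewrite !mxE (eqP (f0 _)).
by have := f0 (enum_rank v); rewrite !mxE enum_rankK => ->.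
Qed.

Lemma laplacian_mx_sym : (laplacian_mx R G)^T = laplacian_mx R G.
Proof.
rewrite /laplacian_mx linearB /= tr_diag_mx; congr (_ - _).
by apply/matrixP => i j; rewrite !mxE adj_sym.
Qed.

Lemma vertex_row_laplacian f :
  vertex_row f *m laplacian_mx R G = vertex_row (laplacian f).
Proof.
apply/rowP => j; rewrite mulmxBr mul_mx_diag !mxE /laplacian.
rewrite sumrB sumr_const -/(degree G (enum_val j)) mulr_natr; congr (_ - _).
rewrite [RHS]big_mkcond.
rewrite (big_enum_val (A := V) (fun u => if _ then f u else 0)) /=.
apply: eq_bigr => i _; rewrite !mxE inE adj_sym.
by case: ifP => _; rewrite ?mulr1 ?mulr0.
Qed.

Lemma laplacian_form f :
  (vertex_row f *m laplacian_mx R G *m (vertex_row f)^T) 0 0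
  = \sum_v f v * laplacian f v.
Proof.
rewrite vertex_row_laplacian vertex_row_dot.
by apply: eq_bigr => v _; rewrite mulrC.
Qed.

(** Each edge contributes two opposite differences. *)
Lemma sum_laplacian f : \sum_v laplacian f v = 0.
Proof.
have E : \sum_v laplacian f v = \sum_v \sum_u (adj G v u)%:R * (f v - f u).
  apply: eq_bigr => v _; rewrite /laplacian big_mkcond.
  by apply: eq_bigr => u _; rewrite inE; case: ifP; rewrite ?mul1r ?mul0r.
suff : \sum_v laplacian f v = - \sum_v laplacian f v by lra.
rewrite {1}E exchange_big E -sumrN; apply: eq_bigr => v _; rewrite -sumrN.
by apply: eq_bigr => u _; rewrite adj_sym -mulrN opprB.
Qed.

Lemma laplacian_const (c : R) v : laplacian (fun=> c) v = 0.
Proof. by rewrite /laplacian big1 // => u _; rewrite subrr. Qed.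

Lemma laplacian_eigenvector (l : R) f v :
  vertex_row f *m laplacian_mx R G = l *: vertex_row f ->
  laplacian f v = l * f v.
Proof.
move/rowP/(_ (enum_rank v)).
by rewrite vertex_row_laplacian !mxE enum_rankK.
Qed.

(** * Test vectors on graphs *)

(** Deleting the neighbors of [v] separates [v] from the nonempty set [T] of its
    non-neighbors.  The test function [f] is constant on each of the two sides
    and 0 on the separating set [N]; the value at [v] is [m = |T|] so that [f]
    sums to 0.  With [k] the degree of [v], its energy is at most
    k m^2 + k m = k |f|^2, since a vertex of [T] has at most [k] neighbors in
    [N]. *)
Lemma algebraic_connectivity_le_degree (v : V) :
  ((degree G v).+1 < #|V|)%N ->
  laplacian_eigenvalue R G #|V|.-1 <= (degree G v)%:R.
Proof.
move=> dv; rewrite /laplacian_eigenvalue.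
set N := neighbors G v; set k : R := (degree G v)%:R.
pose T := ~: (v |: N); pose m : R := #|T|%:R.
have vN : v \notin N by rewrite inE adj_irrefl.
have cT : (#|T| + (degree G v).+1 = #|V|)%N.
  by rewrite -(cardsC (v |: N)) cardsU1 vN add1n addnC.
have m0 : 0 < m by rewrite ltr0n; lia.
pose f u : R := if u == v then m else if u \in N then 0 else -1.
have fv : f v = m by rewrite /f eqxx.
have fN u : u \in N -> f u = 0.
  by rewrite /f => uN; rewrite uN; case: eqP uN vN => // -> ->.
have fT u : u \in T -> f u = -1.
  by rewrite /f !inE negb_or => /andP[/negPf -> /negPf ->].
have split (F : V -> R) :
    \sum_u F u = F v + \sum_(u in N) F u + \sum_(u in T) F u.
  rewrite (bigID [pred u in v |: N]) /= big_setU1 //=.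
  by congr (_ + _); apply: eq_bigl => u; rewrite !inE.
have Lv : laplacian f v = k * m.
  rewrite /laplacian (eq_bigr (fun=> m)) => [|u uN];
    last by rewrite fv fN ?subr0.
  by rewrite sumr_const -mulr_natl.
(* Only neighbors in N count, and there are at most k of them. *)
have LT u : u \in T -> - k <= laplacian f u.
  move=> uT; have nuv : ~~ adj G u v.
    by move: uT; rewrite !inE negb_or adj_sym => /andP[].
  rewrite /laplacian (bigID [pred w in N]) /=.
  rewrite [X in _ + X]big1 ?addr0 => [|w /andP[uw wN]]; last first.
    rewrite (fT u) // fT ?subrr // !inE negb_or -[adj G v w](in_set (adj G v)).
    rewrite wN andbT; apply: contraNneq nuv => <-.
    by rewrite inE in uw.
  rewrite (eq_bigr (fun=> -1)) => [|w /andP[_ wN]];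
    last by rewrite fT // fN ?subr0.
  rewrite sumr_const mulNrn lerN2 ler_nat subset_leq_card //.
  by apply/subsetP => w /andP[].
apply: (@second_smallest_le_rayleigh _ _ _
  (vertex_row (fun=> 1)) (vertex_row f) 0).
- exact: laplacian_mx_sym.
- lia.
- by rewrite vertex_row_eq0; apply/forallPn; exists v; rewrite oner_eq0.
- rewrite vertex_row_laplacian scale0r; apply/eqP.
  by rewrite vertex_row_eq0; apply/forallP => u; rewrite laplacian_const.
- exact: ler0n.
- by rewrite vertex_row_eq0; apply/forallPn; exists v; rewrite fv gt_eqF.
- rewrite vertex_row_dot split fv mulr1 big1 ?addr0 => [|u uN];
    last by rewrite fN ?mul0r.
  rewrite (eq_bigr (fun=> -1)) => [|u uT]; last by rewrite fT ?mulr1.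
  by rewrite sumr_const mulNrn subrr.
- rewrite laplacian_form vertex_row_dot !split Lv fv.
  rewrite big1 ?addr0 => [|u uN]; last by rewrite fN ?mul0r.
  rewrite [X in _ <= _ * (_ + X + _)]big1 ?addr0 => [|u uN];
    last by rewrite fN ?mul0r.
  rewrite [X in _ <= _ * (_ + X)](eq_bigr (fun=> 1)) => [|u uT];
    last by rewrite fT ?mulrNN ?mulr1.
  have -> : \sum_(u in T) (1 : R) = m by rewrite sumr_const.
  have : \sum_(u in T) f u * laplacian f u <= \sum_(u in T) k.
    by apply: ler_sum => u uT; rewrite fT // mulN1r lerNl LT.
  rewrite sumr_const -mulr_natr -/m; lra.
Qed.

(** Strictness is obtained by checking at a single vertex that the test function
    is not an eigenvector. *)
Lemma largest_eigenvalue_gt (c : R) f v :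
  c * \sum_v f v * f v <= \sum_v f v * laplacian f v ->
  laplacian f v != c * f v -> c < laplacian_eigenvalue R G 1.
Proof.
move=> q_ge Lv; rewrite ltNge; apply: contra Lv => le_c; apply/eqP.
apply: laplacian_eigenvector; apply: rayleigh_top_eigenvector => //.
  exact: laplacian_mx_sym.
by rewrite laplacian_form vertex_row_dot.
Qed.

(** The indicator of a vertex has its degree as Rayleigh quotient. *)
Lemma largest_eigenvalue_gt0 x y : adj G x y -> 0 < laplacian_eigenvalue R G 1.
Proof.
move=> xy; pose f u : R := (u == x)%:R.
have Lx : laplacian f x = (degree G x)%:R.
  rewrite /laplacian (eq_bigr (fun=> 1)) ?sumr_const // => u.
  rewrite /f eqxx inE; case: eqP => [->|_ _]; last by rewrite subr0.
  by rewrite adj_irrefl.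
have d0 : 0 < laplacian f x.
  by rewrite Lx ltr0n; apply/card_gt0P; exists y; rewrite inE.
apply: (@largest_eigenvalue_gt _ f x); last by rewrite mul0r gt_eqF.
rewrite mul0r (bigD1 x) //= big1 => [|u ux];
  last by rewrite /f (negPf ux) mul0r.
by rewrite {1}/f eqxx mul1r addr0 ltW.
Qed.

(** The value tau n / n1 is the nonzero eigenvalue of the quotient matrix of the
    partition of the vertices into [S] and its complement, and [f] is the lift to
    the vertices of the corresponding eigenvector.  It is a genuine eigenvector
    only if the partition is equitable, which [v] excludes: the total number of
    edges leaving [S] is positive, but none of them starts at [v]. *)
Lemma regular_set_largest_eigenvalue_gt (S : {set V}) kappa tau v :
  kt_regular G S kappa tau -> (0 < tau)%N -> v \in S ->
  neighbors G v \subset S ->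
  tau%:R * #|V|%:R / #|S|%:R < laplacian_eigenvalue R G 1.
Proof.
case=> S0 SV _ Sc tau0 vS NvS.
pose s : R := #|S|%:R; pose t : R := #|~: S|%:R.
have s0 : 0 < s by rewrite ltr0n card_gt0.
have t0 : 0 < t.
  rewrite ltr0n card_gt0; apply: contraTneq SV => SC0.
  by rewrite -(setCK S) SC0 setC0 properxx.
have nE : #|V|%:R = s + t by rewrite -natrD cardsC.
pose f u : R := if u \in S then t else - s.
have LC u : u \in ~: S -> laplacian f u = - (tau%:R * (s + t)).
  move=> uS; have := uS; rewrite inE => /negPf uS'.
  rewrite /laplacian (bigID [pred w in S]) /=.
  rewrite [X in _ + X]big1 ?addr0 => [|w /andP[_ /negPf wS]]; last first.
    by rewrite /f uS' wS subrr.
  rewrite (eq_bigr (fun=> - (s + t))) => [|w /andP[_ wS]]; last first.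
    by rewrite /f uS' wS opprD.
  rewrite sumr_const mulNrn -[in RHS](Sc _ uS) mulr_natl; congr (- (_ *+ _)).
  by apply: eq_card => w; rewrite [RHS]inE.
have splitS (F : V -> R) :
    \sum_u F u = \sum_(u in S) F u + \sum_(u in ~: S) F u.
  by rewrite (bigID [in S]) /=; congr (_ + _); apply: eq_bigl => u; rewrite inE.
(* The edges leaving S are counted from the other side, through the zero sum. *)
have LS : \sum_(u in S) laplacian f u = t * (tau%:R * (s + t)).
  have := sum_laplacian f; rewrite splitS (eq_bigr _ LC) sumr_const mulNrn.
  by move=> /subr0_eq ->; rewrite -[LHS]mulr_natl.
apply: (@largest_eigenvalue_gt _ f v).
  rewrite !splitS nE.
  rewrite (eq_bigr (fun=> t * t)) => [|u uS]; last by rewrite /f uS.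
  rewrite [X in _ * (_ + X) <= _](eq_bigr (fun=> s * s)) => [|u]; last first.
    by rewrite inE /f => /negPf ->; rewrite mulrNN.
  rewrite [X in _ <= X + _](eq_bigr (fun u => t * laplacian f u))
    => [|u uS]; last first.
    by rewrite {1}/f uS.
  rewrite [X in _ <= _ + X](eq_bigr (fun u => s * (tau%:R * (s + t))))
    => [|u uS]; last first.
    by rewrite LC // /f; move: uS; rewrite inE => /negPf ->; rewrite mulrNN.
  rewrite -[\sum_(u in S) t * laplacian f u]mulr_sumr LS !sumr_const -/s.
  rewrite -[_ *+ #|S|]mulr_natr -[_ *+ #|~: S|]mulr_natr -/s -/t.
  rewrite le_eqVlt; apply/orP; left; apply/eqP.
  by field; rewrite gt_eqF.
rewrite nE -/s /laplacian big1 => [|u uN]; last first.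
  by rewrite /f vS (subsetP NvS) ?subrr.
rewrite /f vS eq_sym gt_eqF //.
by rewrite !mulr_gt0 ?invr_gt0 ?addr_gt0 // ltr0n.
Qed.

End Laplacian.

Theorem corollary15 (R : rcfType) (V : finType) (G : sgraph V)
    (S : {set V}) (n n1 kappa tau : nat) :
  #|V| = n ->
  (exists x y, adj G x y) ->
  kt_regular G S kappa tau ->
  #|S| = n1 ->
  (kappa <= tau)%N ->
  (exists2 v, v \in S & forall w, w \in ~: S -> ~~ adj G v w) ->
  laplacian_spread R G > tau%:R * n%:R / n1%:R - kappa%:R.
Proof.
move=> <- [x [y xy]] reg <- _ [v vS vSc].
have [S0 SV Sk St] := reg.
have NvS : neighbors G v \subset S.
  by apply/subsetP => w; rewrite inE; apply: contraTT => wS;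
    apply: vSc; rewrite inE.
have dv : degree G v = kappa by rewrite -(Sk v vS) (setIidPl NvS).
(* The proper subset S contains v and all its neighbors. *)
have dlt : ((degree G v).+1 < #|V|)%N.
  rewrite -cardsT; apply: leq_trans (proper_card SV).
  rewrite ltnS /degree -[X in (X <= _)%N]add1n.
  have <- : #|v |: neighbors G v| = (1 + #|neighbors G v|)%N.
    by rewrite cardsU1 inE adj_irrefl.
  by rewrite subset_leq_card // subUset sub1set vS.
have := algebraic_connectivity_le_degree R dlt; rewrite dv => le_k.
suff : tau%:R * #|V|%:R / #|S|%:R < laplacian_eigenvalue R G 1.
  by rewrite /laplacian_spread; lra.
have [->|tau0] := posnP tau;
  first by rewrite !mul0r (largest_eigenvalue_gt0 R xy).
exact: regular_set_largest_eigenvalue_gt reg tau0 vS NvS.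
Qed.
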